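(* The category $\mathbf{OWC}$ of operads-with-contraction has an initial object.
   Context: **Globular sets and strict $\omega$-categories.** $\mathbb G$ is the category with objects the natural numbers and arrows generated by $\sigma_n,\tau_n:n\to n-1$ ($n\ge1$) subject to $\sigma_{n-1}\sigma_n=\sigma_{n-1}\tau_n$, $\tau_{n-1}\sigma_n=\tau_{n-1}\tau_n$ ($n\ge2$). A *globular set* is a functor $X:\mathbb G\to\mathbf{Set}$; write $s=X(\sigma_n)$, $t=X(\tau_n)$. Let $T=(T,\eta,\mu)$ be the free strict $\omega$-category monad on $[\mathbb G,\mathbf{Set}]$, i.e. the monad induced by the forgetful functor from (small) strict $\omega$-categories and strict $\omega$-functors to globular sets and its left adjoint. ($T$ is cartesian: it preserves pullbacks and the naturality squares of $\eta$ and $\mu$ are pullbacks.) **$T$-operads.** Let $1$ be the terminal globular set. For objects $d:C\to T1$ and $d':D\to T1$ of $[\mathbb G,\mathbf{Set}]/T1$, let $D\circ C$ be the pullback of $T(!):TC\to T1$ and $d':D\to T1$, with structure map $D\circ C\to TC\xrightarrow{Td}T^21\xrightarrow{\mu_1}T1$. With unit object $\eta_1:1\to T1$ this makes $[\mathbb G,\mathbf{Set}]/T1$ monoidal. A *$T$-operad* is a monoid in this monoidal category, and maps of $T$-operads are monoid maps. For $\nu\in(T1)(n)$ write $C(\nu)=\{\theta\in C(n)\mid d(\theta)=\nu\}$. **Contractions.** Let $C$ be a $T$-operad. For $n\ge2$ and $\pi\in(T1)(n)$, put $P_\pi(C)=\{(\theta_0,\theta_1)\in C(s(\pi))\times C(t(\pi))\mid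 s(\theta_0)=s(\theta_1),\ t(\theta_0)=t(\theta_1)\}$; for $\pi\in(T1)(1)$ put $P_\pi(C)=C(s(\pi))\times C(t(\pi))$. A *contraction* $\kappa$ on $C$ is a family of functions $\kappa_\pi:P_\pi(C)\to C(\pi)$ ($n\ge1$, $\pi\in(T1)(n)$) with $s(\kappa_\pi(\theta_0,\theta_1))=\theta_0$ and $t(\kappa_\pi(\theta_0,\theta_1))=\theta_1$ for all $(\theta_0,\theta_1)\in P_\pi(C)$. An *operad-with-contraction* is a pair $(C,\kappa)$ of a $T$-operad $C$ and a contraction $\kappa$ on $C$. $\mathbf{OWC}$ is the category of these, in which a map $(C,\kappa)\to(C',\kappa')$ is a map $F:C\to C'$ of $T$-operads such that $F(\kappa_\pi(\theta_0,\theta_1))=\kappa'_\pi(F(\theta_0),F(\theta_1))$ for all $n\ge1$, $\pi\in(T1)(n)$, $(\theta_0,\theta_1)\in P_\pi(C)$. *)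

(* Defs.v *)
From mathcomp Require Import all_boot boolp.

Set Implicit Arguments.
Unset Strict Implicit.
Unset Printing Implicit Defensive.

#[local] Obligation Tactic := idtac.

Record category := Category {
  ob : Type;
  hom : ob -> ob -> Type;
  idm : forall a, hom a a;
  compm : forall a b c, hom b c -> hom a b -> hom a c;
  compmA : forall a b c d (h : hom c d) (g : hom b c) (f : hom a b),
    compm h (compm g f) = compm (compm h g) f;
  compm1 : forall a b (f : hom a b), compm f (idm a) = f;
  comp1m : forall a b (f : hom a b), compm (idm b) f = f
}.

Definition is_initial (K : category) (i : ob K) : Prop :=
  forall a : ob K, exists! f : hom i a, True.

Definition has_initial (K : category) : Prop := exists i : ob K, is_initial i.

(* A functor on the category presented by the generators sigma_n, tau_n
   amounts to its values on objects and generators, subject to the images of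
   the defining relations; natural transformations are checked on generators. *)
Record globset := Globset {
  cell :> nat -> Type;
  src : forall n, cell n.+1 -> cell n;
  tgt : forall n, cell n.+1 -> cell n;
  src_src : forall n (x : cell n.+2), src (src x) = src (tgt x);
  tgt_src : forall n (x : cell n.+2), tgt (src x) = tgt (tgt x)
}.
Arguments src {g n} x.
Arguments tgt {g n} x.

Record gmap (X Y : globset) := Gmap {
  gfun :> forall n, X n -> Y n;
  gfun_src : forall n (x : X n.+1), gfun (src x) = src (gfun x);
  gfun_tgt : forall n (x : X n.+1), gfun (tgt x) = tgt (gfun x)
}.

Lemma gmapP (X Y : globset) (f g : gmap X Y) :
  (forall n (x : X n), f n x = g n x) -> f = g.
Proof.
case: f g => [f fs ft] [g gs gt] /= fg.
have {}fg : f = g.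
  by apply: functional_extensionality_dep => n; apply: funext => x.
by rewrite -fg in gs gt *; congr Gmap; exact: Prop_irrelevance.
Qed.

Definition gid (X : globset) : gmap X X :=
  @Gmap X X (fun _ x => x) (fun _ _ => erefl) (fun _ _ => erefl).

Program Definition gcomp (X Y Z : globset) (g : gmap Y Z) (f : gmap X Y) :
  gmap X Z := @Gmap X Z (fun n x => g n (f n x)) _ _.
Next Obligation. by move=> X Y Z g f n x /=; rewrite !gfun_src. Qed.
Next Obligation. by move=> X Y Z g f n x /=; rewrite !gfun_tgt. Qed.

Definition one : globset :=
  @Globset (fun _ => unit) (fun _ _ => tt) (fun _ _ => tt)
           (fun _ _ => erefl) (fun _ _ => erefl).

Definition bang (X : globset) : gmap X one :=
  @Gmap X one (fun _ _ => tt) (fun _ _ => erefl) (fun _ _ => erefl).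

Section Pullback.
Variables (X Y Z : globset) (f : gmap X Z) (g : gmap Y Z).

Definition pb_cell n := {p : X n * Y n | f n p.1 = g n p.2}.

Program Definition pullback : globset :=
  @Globset pb_cell
    (fun n p => exist _ (src (sval p).1, src (sval p).2) _)
    (fun n p => exist _ (tgt (sval p).1, tgt (sval p).2) _) _ _.
Next Obligation. by move=> n [[x y] /= e]; rewrite !gfun_src e. Qed.
Next Obligation. by move=> n [[x y] /= e]; rewrite !gfun_tgt e. Qed.
Next Obligation.
by move=> n [[x y] e]; apply: eq_exist; rewrite /= !src_src.
Qed.
Next Obligation.
by move=> n [[x y] e]; apply: eq_exist; rewrite /= !tgt_src.
Qed.

Definition pb1 : gmap pullback X :=
  @Gmap pullback X (fun _ p => (sval p).1)
        (fun _ _ => erefl) (fun _ _ => erefl).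

Definition pb2 : gmap pullback Y :=
  @Gmap pullback Y (fun _ p => (sval p).2)
        (fun _ _ => erefl) (fun _ _ => erefl).

Program Definition pb_pair (W : globset) (a : gmap W X) (b : gmap W Y)
    (e : forall n (w : W n), f n (a n w) = g n (b n w)) : gmap W pullback :=
  @Gmap W pullback (fun n w => exist _ (a n w, b n w) (e n w)) _ _.
Next Obligation.
by move=> W a b e n w; apply: eq_exist; rewrite /= !gfun_src.
Qed.
Next Obligation.
by move=> W a b e n w; apply: eq_exist; rewrite /= !gfun_tgt.
Qed.

End Pullback.

(* Evidence for p < n in a form along which sources, targets and identities
   can be iterated without transporting cells along equations on dimensions;
   it exists exactly when p < n and is then unique. *)
Inductive below (p : nat) : nat -> Type :=
| below_base : below p p.+1
| below_next n : below p n -> below p n.+1.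
Arguments below_base {p}.
Arguments below_next {p n} _.

Lemma below_ltn p n : below p n -> p < n.
Proof. by elim=> // m _; exact: ltnW. Qed.

Lemma ltn_below p n : p < n -> below p n.
Proof.
elim: n => // n IH pn; case: (eqVneq p n) => [<-|ne]; first exact: below_base.
by apply/below_next/IH; rewrite ltn_neqAle ne -ltnS.
Qed.

Lemma below_irr p n (h h' : below p n) : h = h'.
Proof.
have inv m (k : below p m) :
  match m return below p m -> Prop with
  | 0 => fun _ => False
  | m'.+1 => fun k =>
      (exists e : m' = p, k = ecast i (below p i.+1) (esym e) below_base)
      \/ exists k', k = below_next k'
  end k.
  by case: k => [|m' k']; [left; exists erefl | right; exists k'].
elim: h h' => [|m h IH] h'.
  have [[e ->]|[k _]] := inv _ h'; first by rewrite (eq_irrelevance e erefl).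
  by have := below_ltn k; rewrite ltnn.
have [[e _]|[k ->]] := inv _ h'; last by rewrite (IH k).
by have : false by rewrite -(ltnn p) -{2}e; exact: below_ltn.
Qed.

Section Iterated.
Variable X : globset.

Fixpoint src_to p n (h : below p n) : X n -> X p :=
  match h in below _ n return X n -> X p with
  | below_base => fun x => src x
  | below_next _ h' => fun x => src_to h' (src x)
  end.

Fixpoint tgt_to p n (h : below p n) : X n -> X p :=
  match h in below _ n return X n -> X p with
  | below_base => fun x => tgt x
  | below_next _ h' => fun x => tgt_to h' (tgt x)
  end.

Variable idn : forall n, X n -> X n.+1.

Fixpoint id_to p n (h : below p n) : X p -> X n :=
  match h in below _ n return X p -> X n with
  | below_base => fun x => idn x
  | below_next _ h' => fun x => idn (id_to h' x)
  end.

End Iterated.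
Arguments src_to {X p n} h x.
Arguments tgt_to {X p n} h x.
Arguments id_to {X} idn {p n} h x.

(* [cmp h y x e], with [h : below p n], is the composite of the n-cells x
   followed by y along their common p-cell.  The composability proofs that the
   axioms quantify over follow from those of the composites on the other side
   and the boundary axioms; hence quantifying over them loses nothing. *)
Record omega_cat := OmegaCat {
  ug :> globset;
  cmp : forall p n (h : below p n) (y x : ug n),
    src_to h y = tgt_to h x -> ug n;
  idn : forall n, ug n -> ug n.+1;
  src_cmp_base : forall p (y x : ug p.+1)
    (e : src_to below_base y = tgt_to below_base x),
    src (cmp e) = src x;
  tgt_cmp_base : forall p (y x : ug p.+1)
    (e : src_to below_base y = tgt_to below_base x),
    tgt (cmp e) = tgt y;
  src_cmp_next : forall p n (h : below p n) (y x : ug n.+1)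
    (e : src_to (below_next h) y = tgt_to (below_next h) x)
    (e' : src_to h (src y) = tgt_to h (src x)),
    src (cmp e) = cmp e';
  tgt_cmp_next : forall p n (h : below p n) (y x : ug n.+1)
    (e : src_to (below_next h) y = tgt_to (below_next h) x)
    (e' : src_to h (tgt y) = tgt_to h (tgt x)),
    tgt (cmp e) = cmp e';
  src_idn : forall n (x : ug n), src (idn x) = x;
  tgt_idn : forall n (x : ug n), tgt (idn x) = x;
  cmpA : forall p n (h : below p n) (z y x : ug n)
    (ezy : src_to h z = tgt_to h y) (eyx : src_to h y = tgt_to h x)
    (e1 : src_to h (cmp ezy) = tgt_to h x)
    (e2 : src_to h z = tgt_to h (cmp eyx)),
    cmp e1 = cmp e2;
  cmp1x : forall p n (h : below p n) (x : ug n)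
    (e : src_to h (id_to idn h (tgt_to h x)) = tgt_to h x),
    cmp e = x;
  cmpx1 : forall p n (h : below p n) (x : ug n)
    (e : src_to h x = tgt_to h (id_to idn h (src_to h x))),
    cmp e = x;
  interchange : forall q p n
    (hqp : below q p) (hp : below p n) (hq : below q n)
    (y' y x' x : ug n)
    (ey : src_to hp y' = tgt_to hp y) (ex : src_to hp x' = tgt_to hp x)
    (e' : src_to hq y' = tgt_to hq x') (e : src_to hq y = tgt_to hq x)
    (el : src_to hq (cmp ey) = tgt_to hq (cmp ex))
    (er : src_to hp (cmp e') = tgt_to hp (cmp e)),
    cmp el = cmp er;
  cmp_idn : forall q p (h : below q p) (y x : ug p)
    (e : src_to h y = tgt_to h x)
    (e' : src_to (below_next h) (idn y) = tgt_to (below_next h) (idn x)),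
    cmp e' = idn (cmp e)
}.
Arguments cmp {o p n} h y x e.
Arguments idn {o n} x.

Record omega_functor (A B : omega_cat) := OmegaFunctor {
  ofun :> gmap A B;
  ofun_cmp : forall p n (h : below p n) (y x : A n)
    (e : src_to h y = tgt_to h x)
    (e' : src_to h (ofun n y) = tgt_to h (ofun n x)),
    ofun n (cmp h y x e) = cmp h (ofun n y) (ofun n x) e';
  ofun_idn : forall n (x : A n), ofun n.+1 (idn x) = idn (ofun n x)
}.

Inductive expr (X : nat -> Type) : nat -> Type :=
| Gen n : X n -> expr X n
| Idn n : expr X n -> expr X n.+1
| Cmp p n : below p n -> expr X n -> expr X n -> expr X n.
Arguments Gen {X n} x.
Arguments Idn {X n} t.
Arguments Cmp {X p n} h u t.

(* [eval f t a]: all composites in the expression t make sense in A once its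
   generators are interpreted by f, and its value there is a. *)
Fixpoint eval (X : nat -> Type) (A : omega_cat) (f : forall n, X n -> A n)
    n (t : expr X n) : A n -> Prop :=
  match t in expr _ n return A n -> Prop with
  | Gen n x => fun a => a = f n x
  | Idn n t => fun a => exists2 b, eval f t b & a = idn b
  | Cmp p n h u t => fun a => exists b c (e : src_to h b = tgt_to h c),
      [/\ eval f u b, eval f t c & a = cmp h b c e]
  end.

Lemma eval_fun (X : nat -> Type) (A : omega_cat) (f : forall n, X n -> A n)
    n (t : expr X n) (a b : A n) :
  eval f t a -> eval f t b -> a = b.
Proof.
elim: t a b => {n} [n x|n t IH|p n h u IHu t IHt] a b /=.
- by move=> -> ->.
- by move=> [a' ta ->] [b' tb ->]; rewrite (IH _ _ ta tb).
move=> [a1 [a2 [ea [ua ta ->]]]] [b1 [b2 [eb [ub tb ->]]]].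
have E1 := IHu _ _ ua ub; have E2 := IHt _ _ ta tb.
rewrite -E1 -E2 in eb *.
by rewrite (Prop_irrelevance ea eb).
Qed.

Section Free.
Variable X : globset.

(* Sources and targets of expressions; on 0-dimensional ones the values are
   irrelevant. *)
Fixpoint expr_src n (t : expr X n) : expr X n.-1 :=
  match t in expr _ n return expr X n.-1 with
  | Gen n x => match n return X n -> expr X n.-1 with
               | 0 => fun x => Gen x
               | _.+1 => fun x => Gen (src x)
               end x
  | Idn _ t => t
  | Cmp p n h u t =>
      match h in below _ n return expr X n.-1 -> expr X n.-1 -> expr X n.-1
      with
      | below_base => fun _ t' => t'
      | below_next _ h' => fun u' t' => Cmp h' u' t'
      end (expr_src u) (expr_src t)
  end.

Fixpoint expr_tgt n (t : expr X n) : expr X n.-1 :=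
  match t in expr _ n return expr X n.-1 with
  | Gen n x => match n return X n -> expr X n.-1 with
               | 0 => fun x => Gen x
               | _.+1 => fun x => Gen (tgt x)
               end x
  | Idn _ t => t
  | Cmp p n h u t =>
      match h in below _ n return expr X n.-1 -> expr X n.-1 -> expr X n.-1
      with
      | below_base => fun u' _ => u'
      | below_next _ h' => fun u' t' => Cmp h' u' t'
      end (expr_tgt u) (expr_tgt t)
  end.

(* Two expressions are identified when every map of globular sets from X to a
   strict omega-category gives both of them a value, and the same one; an
   expression is legitimate when it is related to itself.  That the classes of
   legitimate expressions form the free strict omega-category on X is
   [lift_eta] and [lift_unique] below. *)
Definition eqv n (t u : expr X n) : Prop :=
  forall (A : omega_cat) (f : gmap X A),
  exists2 a, eval f t a & eval f u a.

Lemma eqv_sym n (t u : expr X n) : eqv t u -> eqv u t.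
Proof. by move=> tu A f; have [a ta ua] := tu A f; exists a. Qed.

Lemma eqv_trans n (u t v : expr X n) : eqv t u -> eqv u v -> eqv t v.
Proof.
move=> tu uv A f; have [a ta ua] := tu A f; have [b ub vb] := uv A f.
by exists a => //; rewrite (eval_fun ua ub).
Qed.

Definition fcell n :=
  {c : expr X n -> Prop | exists2 t, eqv t t & c = eqv t}.

Definition fclass n (t : expr X n) (wt : eqv t t) : fcell n :=
  exist _ (eqv t)
    (ex_intro2 (fun u => eqv u u) (fun u => eqv t = eqv u) t wt erefl).

Definition frepr n (c : fcell n) : expr X n := s2val (cid2 (svalP c)).

Lemma frepr_eqv n (c : fcell n) : eqv (frepr c) (frepr c).
Proof. by rewrite /frepr; case: (cid2 _). Qed.

Lemma freprE n (c : fcell n) : sval c = eqv (frepr c).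
Proof. by rewrite /frepr; case: (cid2 _). Qed.

Lemma fval_ex n (c : fcell n) (A : omega_cat) (f : gmap X A) :
  exists a, eval f (frepr c) a.
Proof. by have [a] := frepr_eqv c f; exists a. Qed.

Definition fval (A : omega_cat) (f : gmap X A) n (c : fcell n) : A n :=
  sval (cid (fval_ex c f)).

Lemma fvalP (A : omega_cat) (f : gmap X A) n (c : fcell n) :
  eval f (frepr c) (fval f c).
Proof. exact: svalP (cid (fval_ex c f)). Qed.

Lemma fval_inj n (c d : fcell n) :
  (forall (A : omega_cat) (f : gmap X A), fval f c = fval f d) -> c = d.
Proof.
move=> cd; have cdE : eqv (frepr c) (frepr d).
  move=> A f; exists (fval f c); first exact: fvalP.
  by rewrite cd; exact: fvalP.
have : sval c = sval d.
  rewrite !freprE; apply: funext => t; apply: propext; split.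
    exact/eqv_trans/eqv_sym.
  exact/eqv_trans.
by case: c d {cd cdE} => [c hc] [d hd] /= E; apply: eq_exist.
Qed.

Lemma fval_class n (t : expr X n) (wt : eqv t t) (A : omega_cat)
  (f : gmap X A) : eval f t (fval f (fclass wt)).
Proof.
have E : eqv t (frepr (fclass wt)).
  by rewrite (freprE (fclass wt) : eqv t = _); exact: frepr_eqv.
have [a ta ra] := E A f.
by rewrite (eval_fun (fvalP f (fclass wt)) ra).
Qed.

Lemma glob_src_to (Y : globset) p n (h : below p n) (x : Y n.+1) :
  src_to h (src x) = src_to h (tgt x).
Proof. by elim: h x => [|m h IH] x /=; rewrite src_src. Qed.

Lemma glob_tgt_to (Y : globset) p n (h : below p n) (x : Y n.+1) :
  tgt_to h (src x) = tgt_to h (tgt x).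
Proof. by elim: h x => [|m h IH] x /=; rewrite tgt_src. Qed.

Lemma eval_src (A : omega_cat) (f : gmap X A) n (t : expr X n) (a : A n) :
  eval f t a ->
  match n return expr X n.-1 -> A n -> Prop with
  | 0 => fun _ _ => True
  | n'.+1 => fun t' a => eval f t' (src a)
  end (expr_src t) a.
Proof.
elim: t a => {n} [[|n] x|n t IH|p n h u IHu t IHt] a //=.
- by move=> ->; rewrite gfun_src.
- by move=> [b tb ->]; rewrite src_idn.
move=> [b [c [e [ub tc ->]]]].
have {}IHu := IHu _ ub; have {}IHt := IHt _ tc.
case: h b c {ub tc} (expr_src u) (expr_src t) e IHu IHt
  => [|m h] b c u' t' e IHu IHt /=; first by rewrite src_cmp_base.
have e' : src_to h (src b) = tgt_to h (src c).
  by rewrite glob_tgt_to -[RHS]e.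
by exists (src b), (src c), e'; split=> //; exact: src_cmp_next.
Qed.

Lemma eval_tgt (A : omega_cat) (f : gmap X A) n (t : expr X n) (a : A n) :
  eval f t a ->
  match n return expr X n.-1 -> A n -> Prop with
  | 0 => fun _ _ => True
  | n'.+1 => fun t' a => eval f t' (tgt a)
  end (expr_tgt t) a.
Proof.
elim: t a => {n} [[|n] x|n t IH|p n h u IHu t IHt] a //=.
- by move=> ->; rewrite gfun_tgt.
- by move=> [b tb ->]; rewrite tgt_idn.
move=> [b [c [e [ub tc ->]]]].
have {}IHu := IHu _ ub; have {}IHt := IHt _ tc.
case: h b c {ub tc} (expr_tgt u) (expr_tgt t) e IHu IHt
  => [|m h] b c u' t' e IHu IHt /=; first by rewrite tgt_cmp_base.
have e' : src_to h (tgt b) = tgt_to h (tgt c).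
  by rewrite -glob_src_to [LHS]e.
by exists (tgt b), (tgt c), e'; split=> //; exact: tgt_cmp_next.
Qed.

Lemma fsrc_eqv n (c : fcell n.+1) :
  eqv (expr_src (frepr c)) (expr_src (frepr c)).
Proof. by move=> A f; have /eval_src := fvalP f c; eexists; eassumption. Qed.

Lemma ftgt_eqv n (c : fcell n.+1) :
  eqv (expr_tgt (frepr c)) (expr_tgt (frepr c)).
Proof. by move=> A f; have /eval_tgt := fvalP f c; eexists; eassumption. Qed.

Definition fsrc n (c : fcell n.+1) : fcell n := fclass (fsrc_eqv c).
Definition ftgt n (c : fcell n.+1) : fcell n := fclass (ftgt_eqv c).

Lemma fval_src (A : omega_cat) (f : gmap X A) n (c : fcell n.+1) :
  fval f (fsrc c) = src (fval f c).
Proof.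
exact: eval_fun (fval_class (fsrc_eqv c) f) (eval_src (fvalP f c)).
Qed.

Lemma fval_tgt (A : omega_cat) (f : gmap X A) n (c : fcell n.+1) :
  fval f (ftgt c) = tgt (fval f c).
Proof.
exact: eval_fun (fval_class (ftgt_eqv c) f) (eval_tgt (fvalP f c)).
Qed.

Program Definition free_glob : globset := @Globset fcell fsrc ftgt _ _.
Next Obligation.
by move=> n c; apply: fval_inj => A f; rewrite !(fval_src, fval_tgt) src_src.
Qed.
Next Obligation.
by move=> n c; apply: fval_inj => A f; rewrite !(fval_src, fval_tgt) tgt_src.
Qed.

Lemma fval_srcE (A : omega_cat) (f : gmap X A) n (c : free_glob n.+1) :
  fval f (src c) = src (fval f c).
Proof. exact: fval_src. Qed.

Lemma fval_tgtE (A : omega_cat) (f : gmap X A) n (c : free_glob n.+1) :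
  fval f (tgt c) = tgt (fval f c).
Proof. exact: fval_tgt. Qed.

Lemma fval_src_to (A : omega_cat) (f : gmap X A) p n (h : below p n) (c : free_glob n) :
  fval f (src_to h c) = src_to h (fval f c).
Proof.
by elim: h c => [|m h IH] c /=; [exact: fval_src | rewrite IH fval_src].
Qed.

Lemma fval_tgt_to (A : omega_cat) (f : gmap X A) p n (h : below p n) (c : free_glob n) :
  fval f (tgt_to h c) = tgt_to h (fval f c).
Proof.
by elim: h c => [|m h IH] c /=; [exact: fval_tgt | rewrite IH fval_tgt].
Qed.

Lemma fval_composable (A : omega_cat) (f : gmap X A) p n (h : below p n)
    (d c : free_glob n) : src_to h d = tgt_to h c ->
  src_to h (fval f d) = tgt_to h (fval f c).
Proof. by move=> e; rewrite -fval_src_to e fval_tgt_to. Qed.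

Lemma fcmp_eqv p n (h : below p n) (d c : free_glob n)
    (e : src_to h d = tgt_to h c) :
  eqv (Cmp h (frepr d) (frepr c)) (Cmp h (frepr d) (frepr c)).
Proof.
move=> A f; pose a := cmp h _ _ (fval_composable f e).
by exists a; exists (fval f d), (fval f c), (fval_composable f e);
   split=> //; exact: fvalP.
Qed.

Lemma fidn_eqv n (c : free_glob n) : eqv (Idn (frepr c)) (Idn (frepr c)).
Proof.
by move=> A f; exists (idn (fval f c)); exists (fval f c) => //; exact: fvalP.
Qed.

Definition fcmp p n (h : below p n) (d c : free_glob n)
  (e : src_to h d = tgt_to h c) : free_glob n := fclass (fcmp_eqv e).

Definition fidn n (c : free_glob n) : free_glob n.+1 := fclass (fidn_eqv c).

Lemma fval_cmp (A : omega_cat) (f : gmap X A) p n (h : below p n) (d c : free_glob n)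
    (e : src_to h d = tgt_to h c)
    (e' : src_to h (fval f d) = tgt_to h (fval f c)) :
  fval f (fcmp e) = cmp h (fval f d) (fval f c) e'.
Proof.
apply: eval_fun (fval_class (fcmp_eqv e) f) _.
by exists (fval f d), (fval f c), e'; split=> //; exact: fvalP.
Qed.

Lemma fval_idn (A : omega_cat) (f : gmap X A) n (c : free_glob n) :
  fval f (fidn c) = idn (fval f c).
Proof.
apply: eval_fun (fval_class (fidn_eqv c) f) _.
by exists (fval f c) => //; exact: fvalP.
Qed.

Lemma fval_id_to (A : omega_cat) (f : gmap X A) p n (h : below p n) (c : free_glob p) :
  fval f (id_to fidn h c) = id_to (@idn A) h (fval f c).
Proof. by elim: h => [|m h IH] /=; rewrite fval_idn ?IH. Qed.

Lemma cmp_ext (A : omega_cat) p n (h : below p n) (y y' x x' : A n) e e' :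
  y = y' -> x = x' -> cmp h y x e = cmp h y' x' e'.
Proof.
by move=> Ey Ex; subst y' x'; rewrite (Prop_irrelevance e e').
Qed.

Lemma fval_cmpE (A : omega_cat) (f : gmap X A) p n (h : below p n) (d c : free_glob n)
    (e : src_to h d = tgt_to h c) :
  fval f (fcmp e) = cmp h _ _ (fval_composable f e).
Proof. exact: fval_cmp. Qed.

Program Definition free : omega_cat :=
  @OmegaCat free_glob fcmp fidn _ _ _ _ _ _ _ _ _ _ _.
Next Obligation.
move=> p y x e; apply: fval_inj => A f.
by rewrite fval_srcE fval_cmpE src_cmp_base fval_srcE.
Qed.
Next Obligation.
move=> p y x e; apply: fval_inj => A f.
by rewrite fval_tgtE fval_cmpE tgt_cmp_base fval_tgtE.
Qed.
Next Obligation.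
move=> p n h y x e e'; apply: fval_inj => A f.
have := fval_composable f e'; rewrite !fval_srcE => E.
rewrite !fval_cmpE (src_cmp_next _ E).
by apply: cmp_ext; rewrite fval_srcE.
Qed.
Next Obligation.
move=> p n h y x e e'; apply: fval_inj => A f.
have := fval_composable f e'; rewrite !fval_tgtE => E.
rewrite !fval_cmpE (tgt_cmp_next _ E).
by apply: cmp_ext; rewrite fval_tgtE.
Qed.
Next Obligation.
by move=> n x; apply: fval_inj => A f; rewrite fval_srcE fval_idn src_idn.
Qed.
Next Obligation.
by move=> n x; apply: fval_inj => A f; rewrite fval_tgtE fval_idn tgt_idn.
Qed.
Next Obligation.
move=> p n h z y x ezy eyx e1 e2; apply: fval_inj => A f.
have E1 := fval_composable f e1; have E2 := fval_composable f e2.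
rewrite (fval_cmp _ E1) (fval_cmp _ E2); move: E1 E2.
by rewrite !fval_cmpE => E1 E2; exact: cmpA.
Qed.
Next Obligation.
move=> p n h x e; apply: fval_inj => A f.
have E := fval_composable f e; rewrite (fval_cmp _ E); move: E.
by rewrite fval_id_to fval_tgt_to => E; exact: cmp1x.
Qed.
Next Obligation.
move=> p n h x e; apply: fval_inj => A f.
have E := fval_composable f e; rewrite (fval_cmp _ E); move: E.
by rewrite fval_id_to fval_src_to => E; exact: cmpx1.
Qed.
Next Obligation.
move=> q p n hqp hp hq y' y x' x ey ex e' e el er; apply: fval_inj => A f.
have E1 := fval_composable f el; have E2 := fval_composable f er.
rewrite (fval_cmp _ E1) (fval_cmp _ E2); move: E1 E2.
by rewrite !fval_cmpE => E1 E2; exact: interchange hqp _ _ _ _ _ _ _ _ _ _ _ _.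
Qed.
Next Obligation.
move=> q p h y x e e'; apply: fval_inj => A f.
have E := fval_composable f e'; rewrite (fval_cmp _ E); move: E.
by rewrite fval_idn !fval_idn fval_cmpE => E; exact: cmp_idn.
Qed.

Lemma gen_eqv n (x : X n) : eqv (Gen x) (Gen x).
Proof. by move=> A f; exists (f n x). Qed.

Lemma fval_gen (A : omega_cat) (f : gmap X A) n (x : X n) :
  fval f (fclass (gen_eqv x)) = f n x.
Proof. by apply: eval_fun (fval_class (gen_eqv x) f) _. Qed.

Program Definition eta : gmap X free :=
  @Gmap X free (fun n x => fclass (gen_eqv x)) _ _.
Next Obligation.
move=> n x; apply: fval_inj => A f.
by rewrite fval_gen [RHS]fval_src fval_gen gfun_src.
Qed.
Next Obligation.
move=> n x; apply: fval_inj => A f.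
by rewrite fval_gen [RHS]fval_tgt fval_gen gfun_tgt.
Qed.

Program Definition lift (A : omega_cat) (f : gmap X A) :
  omega_functor free A :=
  @OmegaFunctor free A (@Gmap free A (fval f) _ _) _ _.
Next Obligation. by move=> A f n x; exact: fval_src. Qed.
Next Obligation. by move=> A f n x; exact: fval_tgt. Qed.
Next Obligation. by move=> A f p n h y x e e'; exact: fval_cmp. Qed.
Next Obligation. by move=> A f n x; exact: fval_idn. Qed.

Lemma lift_eta (A : omega_cat) (f : gmap X A) : gcomp (lift f) eta = f.
Proof. by apply: gmapP => n x; exact: fval_gen. Qed.

Lemma lift_unique (A : omega_cat) (f : gmap X A) (g : omega_functor free A) :
  gcomp g eta = f -> g = lift f :> gmap free A.
Proof.
move=> gf; apply: gmapP => n c /=.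
suff main (t : expr X n) (wt : eqv t t) : g n (fclass wt) = fval f (fclass wt).
  have -> : c = fclass (frepr_eqv c).
    apply: fval_inj => B k.
    exact: eval_fun (fvalP k c) (fval_class (frepr_eqv c) k).
  exact: main.
elim: t wt {c} => {n} [n x|n t IH|p n h u IHu t IHt] wt.
- by rewrite (Prop_irrelevance wt (gen_eqv x)) fval_gen -gf.
- have wt' : eqv t t by move=> B k; have [a [b tb _]] := wt B k; exists b.
  have -> : fclass wt = idn (fclass wt' : free n).
    apply: fval_inj => B k; rewrite [RHS]fval_idn.
    apply: eval_fun (fval_class wt k) _.
    by exists (fval k (fclass wt')) => //; exact: fval_class.
  by rewrite ofun_idn IH [RHS]fval_idn.
have wu' : eqv u u.
  by move=> B k; have [a [b [b' [_ [ub _ _]]]]] := wt B k; exists b.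
have wt' : eqv t t.
  by move=> B k; have [a [b [b' [_ [_ ub _]]]]] := wt B k; exists b'.
have ek (B : omega_cat) (k : gmap X B) :
    src_to h (fval k (fclass wu')) = tgt_to h (fval k (fclass wt')).
  have [a [b [b' [e [ub tb' _]]]] _] := wt B k.
  rewrite (eval_fun (fval_class wu' k) ub).
  by rewrite (eval_fun (fval_class wt' k) tb').
have e : src_to h (fclass wu' : free n) = tgt_to h (fclass wt' : free n).
  by apply: fval_inj => B k; rewrite fval_src_to fval_tgt_to.
have -> : fclass wt = cmp h (fclass wu' : free n) (fclass wt' : free n) e.
  apply: fval_inj => B k; rewrite [RHS]fval_cmpE.
  apply: eval_fun (fval_class wt k) _.
  exists (fval k (fclass wu')), (fval k (fclass wt')), (fval_composable k e).
  by split=> //; exact: fval_class.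
have e' : src_to h (g n (fclass wu')) = tgt_to h (g n (fclass wt')).
  by rewrite IHu IHt.
by rewrite (ofun_cmp _ e') [RHS]fval_cmpE; apply: cmp_ext.
Qed.

End Free.
Arguments eta {X}.

Definition T (X : globset) : globset := free X.

Definition Tmap (X Y : globset) (f : gmap X Y) : gmap (T X) (T Y) :=
  lift (gcomp (@eta Y) f : gmap X (free Y)).

Definition mu (X : globset) : gmap (T (T X)) (T X) :=
  lift (gid (free X) : gmap (T X) (free X)).
Arguments mu {X}.

Program Definition oid (A : omega_cat) : omega_functor A A :=
  @OmegaFunctor A A (gid A) _ _.
Next Obligation. by move=> A p n h y x e e'; apply: cmp_ext. Qed.
Next Obligation. by []. Qed.

Program Definition ocomp (A B C : omega_cat) (g : omega_functor B C)
  (f : omega_functor A B) : omega_functor A C :=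
  @OmegaFunctor A C (gcomp g f) _ _.
Next Obligation.
move=> A B C g f p n h y x e e' /=.
have E : src_to h (f n y) = tgt_to h (f n x).
  have S (k : gmap A B) z : src_to h (k n z) = k p (src_to h z).
    by elim: h z {y x e e'} => [|m h IH] z /=; rewrite -gfun_src ?IH.
  have S' (k : gmap A B) z : tgt_to h (k n z) = k p (tgt_to h z).
    by elim: h z {y x e e' S} => [|m h IH] z /=; rewrite -gfun_tgt ?IH.
  by rewrite S S' e.
by rewrite (ofun_cmp _ E); exact: ofun_cmp.
Qed.
Next Obligation. by move=> A B C g f n x /=; rewrite !ofun_idn. Qed.

Lemma free_ext (X : globset) (A : omega_cat) (g h : omega_functor (free X) A) :
  gcomp g eta = gcomp h eta -> forall n (x : T X n), g n x = h n x.
Proof.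
move=> gh n x; have Eg := lift_unique gh.
by have Eh := lift_unique (erefl (gcomp h eta)); rewrite Eg -Eh.
Qed.

Lemma lift_etaE (X : globset) (A : omega_cat) (f : gmap X A) n (x : X n) :
  lift f n (eta n x) = f n x.
Proof. exact: fval_gen. Qed.

Lemma Tmap_id (X : globset) n (x : T X n) : Tmap (gid X) n x = x.
Proof.
apply: (@free_ext X (free X) (lift _) (oid _)).
by apply: gmapP => m y /=; rewrite fval_gen.
Qed.

Lemma Tmap_ext (X Y : globset) (f g : gmap X Y) n (x : T X n) :
  (forall m (y : X m), f m y = g m y) -> Tmap f n x = Tmap g n x.
Proof. by move=> /gmapP ->. Qed.

Lemma Tmap_comp (X Y Z : globset) (g : gmap Y Z) (f : gmap X Y) n
  (x : T X n) : Tmap (gcomp g f) n x = Tmap g n (Tmap f n x).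
Proof.
apply: (@free_ext X (free Z) (lift _) (ocomp (lift _) (lift _))).
by apply: gmapP => m y /=; rewrite !fval_gen.
Qed.

Lemma Tmap_eta (X Y : globset) (f : gmap X Y) n (x : X n) :
  Tmap f n (eta n x) = eta n (f n x).
Proof. exact: fval_gen. Qed.

Lemma mu_nat (X Y : globset) (f : gmap X Y) n (x : T (T X) n) :
  mu n (Tmap (Tmap f) n x) = Tmap f n (mu n x).
Proof.
apply: (@free_ext (T X) (free Y) (ocomp (lift _) (lift _))
          (ocomp (lift _) (lift _))).
by apply: gmapP => m y /=; rewrite !fval_gen.
Qed.

Lemma mu_eta (X : globset) n (x : T X n) : mu n (eta n x) = x.
Proof. exact: fval_gen. Qed.

Lemma mu_Teta (X : globset) n (x : T X n) : mu n (Tmap eta n x) = x.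
Proof.
apply: (@free_ext X (free X) (ocomp (lift _) (lift _)) (oid _)).
by apply: gmapP => m y /=; rewrite !fval_gen.
Qed.

Lemma mu_mu (X : globset) n (x : T (T (T X)) n) :
  mu n (mu n x) = mu n (Tmap mu n x).
Proof.
apply: (@free_ext (T (T X)) (free X) (ocomp (lift _) (lift _))
          (ocomp (lift _) (lift _))).
by apply: gmapP => m y /=; rewrite !fval_gen.
Qed.

#[local] Opaque eta Tmap mu.

Record coll := Coll {
  cg :> globset;
  ar : gmap cg (T one)
}.
Arguments ar {c}.

Record cmap (C D : coll) := Cmap {
  cfun :> gmap C D;
  ar_cfun : forall n (x : C n), ar n (cfun n x) = ar n x
}.

Lemma cmapP (C D : coll) (f g : cmap C D) :
  (forall n (x : C n), f n x = g n x) -> f = g.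
Proof.
case: f g => [f fa] [g ga] /= /gmapP fg.
by rewrite -fg in ga *; congr Cmap; exact: Prop_irrelevance.
Qed.

Definition cid_map (C : coll) : cmap C C := @Cmap C C (gid C) (fun _ _ => erefl).

Program Definition ccomp (C D E : coll) (g : cmap D E) (f : cmap C D) :
  cmap C E := @Cmap C E (gcomp g f) _.
Next Obligation. by move=> C D E g f n x /=; rewrite !ar_cfun. Qed.

(* [tens D C] is D o C: cells of C are plugged into those of D. *)
Definition tens (D C : coll) : coll :=
  @Coll (pullback (Tmap (bang C)) (@ar D))
        (gcomp (gcomp mu (Tmap (@ar C))) (pb1 _ _)).

Definition cunit : coll := @Coll one eta.

Lemma Tbang (X Y : globset) (f : gmap X Y) n (x : T X n) :
  Tmap (bang Y) n (Tmap f n x) = Tmap (bang X) n x.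
Proof. by rewrite -Tmap_comp; exact: Tmap_ext. Qed.

Program Definition tens_map (D D' C C' : coll)
    (g : cmap D D') (f : cmap C C') : cmap (tens D C) (tens D' C') :=
  @Cmap (tens D C) (tens D' C')
    (@pb_pair _ _ _ (Tmap (bang C')) (@ar D') _
       (gcomp (Tmap f) (pb1 _ _)) (gcomp g (pb2 _ _)) _) _.
Next Obligation.
by move=> D D' C C' g f n [[x y] /= e]; rewrite Tbang e ar_cfun.
Qed.
Next Obligation.
move=> D D' C C' g f n [[x y] /= e]; rewrite -Tmap_comp.
by congr (mu n _); apply: Tmap_ext => m z; rewrite /= ar_cfun.
Qed.

(* Canonical comparison maps, in the directions that exist for any monad.
   Since T is cartesian they are invertible: they are the inverses of the
   associator (E o D) o C -> E o (D o C) and of the unit isomorphisms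
   1 o C -> C and C o 1 -> C. *)
Program Definition tensA (E D C : coll) :
  cmap (tens E (tens D C)) (tens (tens E D) C) :=
  @Cmap (tens E (tens D C)) (tens (tens E D) C)
    (@pb_pair _ _ _ (Tmap (bang C)) (@ar (tens E D)) _
      (gcomp (gcomp mu (Tmap (pb1 (Tmap (bang C)) (@ar D)))) (pb1 _ _))
      (@pb_pair _ _ _ (Tmap (bang D)) (@ar E) _
         (gcomp (Tmap (pb2 (Tmap (bang C)) (@ar D))) (pb1 _ _)) (pb2 _ _) _)
      _) _.
Next Obligation. by move=> E D C n [[z y] /= e]; rewrite Tbang -e. Qed.
Next Obligation.
move=> E D C n [[z y] /= e]; rewrite -mu_nat -!Tmap_comp.
congr (mu n _); apply: Tmap_ext => m w /=.
exact: (svalP w).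
Qed.
Next Obligation.
move=> E D C n [[z y] /= e]; rewrite -mu_nat mu_mu -!Tmap_comp.
by congr (mu n _); exact: Tmap_ext.
Qed.

Program Definition tens1C (C : coll) : cmap C (tens cunit C) :=
  @Cmap C (tens cunit C)
    (@pb_pair _ _ _ (Tmap (bang C)) (@ar cunit) _ eta (bang C) _) _.
Next Obligation. by move=> C n x; rewrite Tmap_eta. Qed.
Next Obligation. by move=> C n x /=; rewrite Tmap_eta mu_eta. Qed.

Program Definition tensC1 (C : coll) : cmap C (tens C cunit) :=
  @Cmap C (tens C cunit)
    (@pb_pair _ _ _ (Tmap (bang cunit)) (@ar C) _ (@ar C) (gid C) _) _.
Next Obligation.
move=> C n x /=; rewrite -[RHS]Tmap_id.
by apply: Tmap_ext => m [].
Qed.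
Next Obligation. by move=> C n x /=; exact: mu_Teta. Qed.

Record operad := Operad {
  oc :> coll;
  omul : cmap (tens oc oc) oc;
  ounit : cmap cunit oc;
  omulA : ccomp omul (tens_map (cid_map oc) omul) =
          ccomp (ccomp omul (tens_map omul (cid_map oc))) (tensA oc oc oc);
  omul1x : ccomp (ccomp omul (tens_map ounit (cid_map oc))) (tens1C oc) =
           cid_map oc;
  omulx1 : ccomp (ccomp omul (tens_map (cid_map oc) ounit)) (tensC1 oc) =
           cid_map oc
}.
Arguments omul {o}.
Arguments ounit {o}.

Record operad_map (C D : operad) := OperadMap {
  opfun :> cmap C D;
  opfun_mul : ccomp opfun omul = ccomp omul (tens_map opfun opfun);
  opfun_unit : ccomp opfun ounit = ounit
}.

Lemma operad_mapP (C D : operad) (f g : operad_map C D) :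
  (forall n (x : C n), f n x = g n x) -> f = g.
Proof.
case: f g => [f f1 f2] [g g1 g2] /= /cmapP fg.
by rewrite -fg in g1 g2 *; congr OperadMap; exact: Prop_irrelevance.
Qed.

Definition fiber (C : coll) n (v : T one n) := {x : C n | ar n x = v}.

Definition parallel (X : globset) n : X n -> X n -> Prop :=
  match n return X n -> X n -> Prop with
  | 0 => fun _ _ => True
  | _.+1 => fun x y => src x = src y /\ tgt x = tgt y
  end.

(* P_pi(C), for pi of dimension n.+1: both of its cases are covered, as
   [parallel] is no condition on 0-cells. *)
Record ppair (C : coll) n (pi : T one n.+1) := PPair {
  pp0 : fiber C (src pi);
  pp1 : fiber C (tgt pi);
  pp_par : parallel (sval pp0) (sval pp1)
}.

Record contraction (C : coll) := Contraction {
  kap : forall n (pi : T one n.+1), ppair C pi -> fiber C pi;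
  src_kap : forall n (pi : T one n.+1) (p : ppair C pi),
    src (sval (kap p)) = sval (pp0 p);
  tgt_kap : forall n (pi : T one n.+1) (p : ppair C pi),
    tgt (sval (kap p)) = sval (pp1 p)
}.

Program Definition fiber_map (C D : coll) (f : cmap C D) n (v : T one n)
  (x : fiber C v) : fiber D v := exist _ (f n (sval x)) _.
Next Obligation. by move=> C D f n v [x /= <-]; exact: ar_cfun. Qed.

Lemma parallel_map (X Y : globset) (f : gmap X Y) n (x y : X n) :
  parallel x y -> parallel (f n x) (f n y).
Proof.
case: n x y => [|n] x y //= [es et].
by rewrite -!gfun_src -!gfun_tgt es et.
Qed.

Definition ppair_map (C D : coll) (f : cmap C D) n (pi : T one n.+1)
    (p : ppair C pi) : ppair D pi :=
  @PPair D n pi (fiber_map f (pp0 p)) (fiber_map f (pp1 p))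
         (parallel_map f (pp_par p)).

Arguments kap {C} c {n pi} p.

Record owc := Owc {
  owc_op :> operad;
  owc_kap : contraction owc_op
}.

Record owc_map (C D : owc) := OwcMap {
  owcfun :> operad_map C D;
  owcfun_kap : forall n (pi : T one n.+1) (p : ppair C pi),
    fiber_map owcfun (kap (owc_kap C) p) = kap (owc_kap D) (ppair_map owcfun p)
}.

Lemma owc_mapP (C D : owc) (f g : owc_map C D) :
  (forall n (x : C n), f n x = g n x) -> f = g.
Proof.
case: f g => [f f1] [g g1] /= /operad_mapP fg.
by rewrite -fg in g1 *; congr OwcMap; exact: Prop_irrelevance.
Qed.

Lemma fiberP (C : coll) n (v : T one n) (x y : fiber C v) :
  sval x = sval y -> x = y.
Proof. by case: x y => [x ex] [y ey] /=; exact: eq_exist. Qed.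

Lemma ppairP (C : coll) n (pi : T one n.+1) (p q : ppair C pi) :
  sval (pp0 p) = sval (pp0 q) -> sval (pp1 p) = sval (pp1 q) -> p = q.
Proof.
case: p q => [[a ea] [b eb] h] [[a' ea'] [b' eb'] h'] /= Ea Eb.
subst a' b'; rewrite (Prop_irrelevance ea ea') in h *.
rewrite (Prop_irrelevance eb eb') in h *.
by rewrite (Prop_irrelevance h h').
Qed.

Program Definition operad_id (C : operad) : operad_map C C :=
  @OperadMap C C (cid_map C) _ _.
Next Obligation.
move=> C; apply: cmapP => n [[x y] e] /=; congr (omul n _).
by apply: eq_exist; rewrite /= Tmap_id.
Qed.
Next Obligation. by move=> C; exact: cmapP. Qed.

Program Definition operad_comp (C D E : operad)
    (g : operad_map D E) (f : operad_map C D) : operad_map C E :=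
  @OperadMap C E (ccomp g f) _ _.
Next Obligation.
move=> C D E g f; apply: cmapP => n x.
have Ef := congr1 (fun k : cmap (tens C C) D => k n x) (opfun_mul f).
have Eg := congr1 (fun k : cmap (tens D D) E => k n (tens_map f f n x))
                  (opfun_mul g).
rewrite /= in Ef Eg; rewrite /= Ef Eg; congr (omul n _).
by apply: eq_exist; rewrite /= -Tmap_comp.
Qed.
Next Obligation.
move=> C D E g f; rewrite -(opfun_unit g) -(opfun_unit f).
exact: cmapP.
Qed.

Program Definition owc_id (C : owc) : owc_map C C :=
  @OwcMap C C (operad_id C) _.
Next Obligation.
move=> C n pi p.
have -> : ppair_map (operad_id C) p = p by exact: ppairP.
exact: fiberP.
Qed.

Program Definition owc_comp (C D E : owc) (g : owc_map D E) (f : owc_map C D) :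
  owc_map C E := @OwcMap C E (operad_comp g f) _.
Next Obligation.
move=> C D E g f n pi p.
have -> : ppair_map (operad_comp g f) p = ppair_map g (ppair_map f p).
  exact: ppairP.
by rewrite -owcfun_kap -owcfun_kap; exact: fiberP.
Qed.

Program Definition OWC : category :=
  @Category owc owc_map owc_id owc_comp _ _ _.
Next Obligation. by move=> *; exact: owc_mapP. Qed.
Next Obligation. by move=> *; exact: owc_mapP. Qed.
Next Obligation. by move=> *; exact: owc_mapP. Qed.

(* Main.v *)
From mathcomp Require Import all_boot boolp.
Require Import Defs.

(** An operad-with-contraction is a model of an essentially algebraic theory:
it carries partial operations (sources and targets, units, operadic
composition of a cell with a pasting diagram of cells, contraction), each
defined on a domain cut out by equations.  The initial model of such a theory
is the set of closed terms that denote, modulo equality of denotations.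

Taking all operads-with-contraction at once as the models in which terms are
tested avoids any deductive calculus: a term is legitimate when it has a value
in every operad-with-contraction, and two terms are identified when their
values agree in every one ([equiv]).  This quantification over a large
collection of models takes place in a proposition, so that the classes of
terms are still small.

By construction the valuations [ival C], for C ranging over all
operads-with-contraction, are jointly injective ([ival_inj]), and each
operation on classes is computed by the corresponding operation on values.
Hence every equation that holds in all C holds for classes: the globular
identities, and the operad laws ([reflected_operad]).  An arity must be a
single element of T1 independent of C; it is obtained as the value in the
terminal operad-with-contraction, which is T1 itself ([arity_owc]).  It agrees
with the arity of the value in any C because maps preserve values
([evals_map]), and taking arities is a map from C to the terminal object.

The valuations are then the maps out of the initial object.  They are unique
because any map f : I -> C sends the value of a term in I to its value in C
([ival_map]), while every cell of I is its own value in I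
([valuation_self]). *)

Set Implicit Arguments.
Unset Strict Implicit.
Unset Printing Implicit Defensive.

#[local] Obligation Tactic := idtac.

(* Keeps simplification from unfolding T into values of expressions. *)
#[local] Opaque eta Tmap mu.

(** * Maps of collections and naturality of the comparison maps *)

Lemma cmap_app (C D : coll) (f g : cmap C D) :
  f = g -> forall n (x : C n), f n x = g n x.
Proof. by move->. Qed.

Lemma cmap_ar_eq (C D : coll) (f g : cmap C D) :
  (forall n, injective (@ar D n)) -> f = g.
Proof. by move=> inj; apply: cmapP => n x; apply: inj; rewrite !ar_cfun. Qed.

Lemma tensA_nat (E E' D D' C C' : coll) (f : cmap E E') (g : cmap D D')
    (h : cmap C C') :
  ccomp (tensA E' D' C') (tens_map f (tens_map g h)) =
  ccomp (tens_map (tens_map f g) h) (tensA E D C).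
Proof.
apply: cmapP => n [[z y] e]; apply: eq_exist; congr pair => /=.
  by rewrite -mu_nat -!Tmap_comp; congr (mu n _); exact: Tmap_ext.
by apply: eq_exist; rewrite /= -!Tmap_comp; congr pair; exact: Tmap_ext.
Qed.

Lemma ccompA (B C D E : coll) (h : cmap D E) (g : cmap C D) (f : cmap B C) :
  ccomp h (ccomp g f) = ccomp (ccomp h g) f.
Proof. exact: cmapP. Qed.

Lemma ccomp1m (C D : coll) (f : cmap C D) : ccomp (cid_map D) f = f.
Proof. exact: cmapP. Qed.

Lemma ccompm1 (C D : coll) (f : cmap C D) : ccomp f (cid_map C) = f.
Proof. exact: cmapP. Qed.

Lemma tens_map_comp (D D' D'' C C' C'' : coll) (g' : cmap D' D'')
    (g : cmap D D') (f' : cmap C' C'') (f : cmap C C') :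
  ccomp (tens_map g' f') (tens_map g f) =
  tens_map (ccomp g' g) (ccomp f' f).
Proof.
apply: cmapP => n [[z y] e]; apply: eq_exist.
by rewrite /= -Tmap_comp; congr pair.
Qed.

Lemma tens1C_nat (C C' : coll) (f : cmap C C') :
  ccomp (tens1C C') f = ccomp (tens_map (cid_map cunit) f) (tens1C C).
Proof.
by apply: cmapP => n x; apply: eq_exist; rewrite /= Tmap_eta.
Qed.

Lemma tensC1_nat (C C' : coll) (f : cmap C C') :
  ccomp (tensC1 C') f = ccomp (tens_map f (cid_map cunit)) (tensC1 C).
Proof.
by apply: cmapP => n x; apply: eq_exist; rewrite /= Tmap_id ar_cfun.
Qed.

(** * Operad structures reflected along a jointly injective family *)

Section JointlyInjective.
Variables (I : coll) (m : cmap (tens I I) I) (u : cmap cunit I).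
Variables (J : Type) (O : J -> operad) (v : forall j, cmap I (O j)).
Hypothesis v_inj : forall n (x y : I n), (forall j, v j n x = v j n y) -> x = y.
Hypothesis v_mul : forall j, ccomp (v j) m = ccomp omul (tens_map (v j) (v j)).
Hypothesis v_unit : forall j, ccomp (v j) u = ounit.

Let v_monic C (f g : cmap C I) :
  (forall j, ccomp (v j) f = ccomp (v j) g) -> f = g.
Proof.
move=> fg; apply: cmapP => n x; apply: v_inj => j.
exact: cmap_app (fg j) _ x.
Qed.

(** The two sides of each law are maps into I; after composition with any [v j]
they become the two sides of the same law in [O j], precomposed with a tensor
power of [v j], by naturality of the comparison maps. *)
Program Definition reflected_operad : operad := @Operad I m u _ _ _.
Next Obligation.
apply: v_monic => j; have V := v_mul j.
have L : ccomp (v j) (ccomp m (tens_map (cid_map I) m)) =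
    ccomp (ccomp omul (tens_map (cid_map (O j)) omul))
          (tens_map (v j) (tens_map (v j) (v j))).
  by rewrite ccompA V -!ccompA !tens_map_comp V ccompm1 ccomp1m.
have R : ccomp (v j) (ccomp m (tens_map m (cid_map I))) =
    ccomp (ccomp omul (tens_map omul (cid_map (O j))))
          (tens_map (tens_map (v j) (v j)) (v j)).
  by rewrite ccompA V -!ccompA !tens_map_comp V ccompm1 ccomp1m.
by rewrite L omulA -ccompA tensA_nat ccompA -R -[LHS]ccompA.
Qed.
Next Obligation.
apply: v_monic => j.
rewrite !ccompA v_mul -(ccompA omul) tens_map_comp v_unit !ccompm1.
rewrite -(ccompm1 ounit) -[X in tens_map _ X]ccomp1m -tens_map_comp.
by rewrite ccompA -ccompA -tens1C_nat ccompA omul1x ccomp1m.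
Qed.
Next Obligation.
apply: v_monic => j.
rewrite !ccompA v_mul -(ccompA omul) tens_map_comp v_unit !ccompm1.
rewrite -(ccompm1 ounit) -[X in tens_map X _]ccomp1m -tens_map_comp.
by rewrite ccompA -ccompA -tensC1_nat ccompA omulx1 ccomp1m.
Qed.
End JointlyInjective.

#[local] Transparent eta Tmap mu.

(** * The terminal operad-with-contraction *)

(** T1 over itself by the identity is terminal among collections, so its operad
structure is forced and the laws are automatic. *)
Program Definition arity_operad : operad :=
  @Operad (@Coll (T one) (gid _)) (@Cmap _ (Coll (gid _)) (@ar (tens _ _)) _)
     (@Cmap _ (Coll (gid _)) eta _) _ _ _.
Next Obligation. by []. Qed.
Next Obligation. by []. Qed.
Next Obligation. by apply: cmap_ar_eq => n x y. Qed.
Next Obligation. by apply: cmap_ar_eq => n x y. Qed.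
Next Obligation. by apply: cmap_ar_eq => n x y. Qed.

Program Definition arity_owc : owc :=
  @Owc arity_operad (@Contraction _ (fun n pi _ => exist _ pi erefl) _ _).
Next Obligation. by move=> n pi p; exact: esym (svalP (pp0 p)). Qed.
Next Obligation. by move=> n pi p; exact: esym (svalP (pp1 p)). Qed.

Program Definition to_arity (C : owc) : owc_map C arity_owc :=
  @OwcMap C arity_owc
    (@OperadMap C arity_owc (@Cmap C arity_owc (@ar C) _) _ _) _.
Next Obligation. by []. Qed.
Next Obligation. by move=> C; apply: cmap_ar_eq => n x y. Qed.
Next Obligation. by move=> C; apply: cmap_ar_eq => n x y. Qed.
Next Obligation.
by move=> C n pi p; apply: fiberP; rewrite /= (svalP (kap _ p)).
Qed.

(** * Terms and their values *)

(** Terms come in two kinds because an operadic composite involves both a cell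
of the operad C and a cell of TC, that is, a pasting diagram of cells of C. *)
Inductive kind := Cell | Diagram.

(** Sources and targets are term constructors rather than functions computed
on terms; this makes the globular structure on classes immediate, and the
redundant terms are absorbed by the identification of terms of equal value. *)
Inductive term : kind -> nat -> Type :=
| Unit n : term Cell n
| Src n : term Cell n.+1 -> term Cell n
| Tgt n : term Cell n.+1 -> term Cell n
| Mul n : term Diagram n -> term Cell n -> term Cell n
| Kap n : T one n.+1 -> term Cell n -> term Cell n -> term Cell n.+1
| DGen n : term Cell n -> term Diagram n
| DIdn n : term Diagram n -> term Diagram n.+1
| DCmp p n : below p n -> term Diagram n -> term Diagram n -> term Diagram n.

Definition value (C : owc) (k : kind) : globset :=
  match k with Cell => C | Diagram => T C end.

(** The value of a term is given by a relation since the operations are partial: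
a composite or a contraction has a value only if the values of its arguments
fit together. *)
Fixpoint evals (C : owc) k n (t : term k n) : value C k n -> Prop :=
  match t in term k n return value C k n -> Prop with
  | Unit n => fun c => c = ounit n tt
  | Src n t => fun c => exists2 b : C n.+1, evals t b & c = src b
  | Tgt n t => fun c => exists2 b : C n.+1, evals t b & c = tgt b
  | Mul n d t => fun c => exists x : tens C C n,
      [/\ @evals C Diagram n d (sval x).1, @evals C Cell n t (sval x).2
        & c = omul n x]
  | Kap n pi t u => fun c => exists q : ppair C pi,
      [/\ @evals C Cell n t (sval (pp0 q)), @evals C Cell n u (sval (pp1 q))
        & c = sval (kap (owc_kap C) q)]
  | DGen n t => fun z => exists2 c : C n, @evals C Cell n t c & z = eta n c
  | DIdn n d => fun z => exists2 w : free C n,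
      @evals C Diagram n d w & z = @idn (free C) n w
  | DCmp p n h d e => fun z =>
      exists (y x : free C n) (yx : src_to h y = tgt_to h x),
      [/\ @evals C Diagram n d y, @evals C Diagram n e x & z = cmp h y x yx]
  end.

Lemma evals_fun (C : owc) k n (t : term k n) (a b : value C k n) :
  evals t a -> evals t b -> a = b.
Proof.
elim: t a b => {k n} [n|n t IH|n t IH|n d IHd t IHt|n pi t IHt u IHu
  |n t IH|n d IH|p n h d IHd e IHe] a b /=.
- by move=> -> ->.
- by move=> [a' ta ->] [b' tb ->]; rewrite (IH _ _ ta tb).
- by move=> [a' ta ->] [b' tb ->]; rewrite (IH _ _ ta tb).
- move=> [x [dx tx ->]] [y [dy ty ->]]; congr (omul n _).
  move: x y dx tx dy ty => [[z c] e] [[z' c'] e'] /= dx tx dy ty.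
  by apply: eq_exist; rewrite (IHd _ _ dx dy) (IHt _ _ tx ty).
- move=> [x [tx ux ->]] [y [ty uy ->]]; congr (sval (kap _ _)).
  by apply: ppairP; [exact: IHt tx ty | exact: IHu ux uy].
- by move=> [a' ta ->] [b' tb ->]; rewrite (IH _ _ ta tb).
- by move=> [a' ta ->] [b' tb ->]; rewrite (IH _ _ ta tb).
move=> [y [x [yx [dy ex ->]]]] [y' [x' [yx' [dy' ex' ->]]]].
exact: cmp_ext (IHd _ _ dy dy') (IHe _ _ ex ex').
Qed.

Definition value_map (C D : owc) (f : owc_map C D) (k : kind) :
    gmap (value C k) (value D k) :=
  match k with Cell => f | Diagram => Tmap f end.

Lemma gfun_src_to (X Y : globset) (f : gmap X Y) p n (h : below p n) (x : X n) :
  f p (src_to h x) = src_to h (f n x).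
Proof. by elim: h x => [|m h IH] x /=; rewrite ?IH gfun_src. Qed.

Lemma gfun_tgt_to (X Y : globset) (f : gmap X Y) p n (h : below p n) (x : X n) :
  f p (tgt_to h x) = tgt_to h (f n x).
Proof. by elim: h x => [|m h IH] x /=; rewrite ?IH gfun_tgt. Qed.

Lemma Tmap_idn (X Y : globset) (f : gmap X Y) n (z : free X n) :
  Tmap f n.+1 (idn z) = @idn (free Y) n (Tmap f n z).
Proof. exact: (ofun_idn (lift (gcomp eta f : gmap X (free Y))) z). Qed.

Lemma Tmap_cmp (X Y : globset) (f : gmap X Y) p n (h : below p n)
    (y x : free X n) (e : src_to h y = tgt_to h x)
    (e' : src_to h (Tmap f n y) = tgt_to h (Tmap f n x)) :
  Tmap f n (cmp h y x e) = @cmp (free Y) p n h _ _ e'.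
Proof. exact: (ofun_cmp (o := lift (gcomp eta f : gmap X (free Y)))). Qed.

(** Maps of operads-with-contraction preserve all the operations, hence values.
With determinism of values, this is the source both of the compatibility of
the valuations with arities and of the uniqueness of maps out of the initial
object. *)
Lemma evals_map (C D : owc) (f : owc_map C D) k n (t : term k n)
    (a : value C k n) : evals t a -> evals t (value_map f k n a).
Proof.
elim: t a => {k n} [n|n t IH|n t IH|n d IHd t IHt|n pi t IHt u IHu
  |n t IH|n d IH|p n h d IHd e IHe] a /=.
- by move=> ->; exact: cmap_app (opfun_unit f) _ tt.
- by move=> [b tb ->]; exists (f _ b); [exact: IH tb | exact: gfun_src].
- by move=> [b tb ->]; exists (f _ b); [exact: IH tb | exact: gfun_tgt].
- move=> [x [dx tx ->]]; exists (tens_map f f n x).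
  split; [exact: IHd dx | exact: IHt tx |].
  exact: cmap_app (opfun_mul f) _ x.
- move=> [q [tq uq ->]]; exists (ppair_map f q).
  split; [exact: IHt tq | exact: IHu uq |].
  by have /(congr1 sval) := owcfun_kap f q.
- by move=> [c tc ->]; exists (f n c); [exact: IH tc | exact: Tmap_eta].
- move=> [w dw ->]; exists (Tmap f n w); first exact: IH dw.
  exact: (Tmap_idn f w).
move=> [y [x [yx [dy ex ->]]]].
have yx' : src_to h (Tmap f n y) = tgt_to h (Tmap f n x).
  by rewrite -gfun_src_to yx gfun_tgt_to.
exists (Tmap f n y), (Tmap f n x), yx'.
split; [exact: IHd dy | exact: IHe ex |].
exact: (@Tmap_cmp C D f p n h y x yx yx').
Qed.

(** * Classes of terms *)

(** A term without a value in some C is related to nothing, so that the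
legitimate terms are exactly those related to themselves. *)
Definition equiv n (t u : term Cell n) : Prop :=
  forall C : owc, exists2 a : C n, evals t a & evals u a.

Definition icell n :=
  {c : term Cell n -> Prop | exists2 t, equiv t t & c = equiv t}.

Definition iclass n (t : term Cell n) (wt : equiv t t) : icell n :=
  exist _ (equiv t)
    (ex_intro2 (fun u => equiv u u) (fun u => equiv t = equiv u) t wt erefl).

Lemma ival_ex (C : owc) n (c : icell n) :
  exists a : C n, forall t, sval c t -> evals t a.
Proof.
case: c => [c [t wt /= ->]]; have [a ta _] := wt C; exists a => u tu.
by have [b tb ub] := tu C; rewrite (evals_fun ta tb).
Qed.

Definition ival (C : owc) n (c : icell n) : C n := sval (cid (ival_ex C c)).

Lemma ivalP (C : owc) n (c : icell n) t :
  sval c t -> evals t (ival C c).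
Proof. exact: svalP (cid (ival_ex C c)) t. Qed.

Lemma irepr_ex n (c : icell n) : exists t, sval c t.
Proof. by case: c => [c [t wt /= ->]]; exists t. Qed.

Definition irepr n (c : icell n) : term Cell n := sval (cid (irepr_ex c)).

Lemma ireprP (C : owc) n (c : icell n) : evals (irepr c) (ival C c).
Proof. exact/ivalP/(svalP (cid (irepr_ex c))). Qed.

Lemma ival_class (C : owc) n (t : term Cell n) (wt : equiv t t) (a : C n) :
  evals t a -> ival C (iclass wt) = a.
Proof. by move=> ta; apply: evals_fun ta; exact: (@ivalP C n (iclass wt)). Qed.

(** A class is recovered from its values: it consists of the terms that denote
them. *)
Lemma ival_inj n (c d : icell n) :
  (forall C : owc, ival C c = ival C d) -> c = d.
Proof.
have valE (b : icell n) t : sval b t <-> forall C : owc, evals t (ival C b).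
  split=> [bt C|bt]; first exact: ivalP.
  have [u uu bE] := svalP b; rewrite bE => C.
  by exists (ival C b); [apply: ivalP; rewrite bE | exact: bt].
move=> cd; have: sval c = sval d.
  by apply: funext => t; apply: propext; rewrite !valE; split=> ct C;
     [rewrite -cd | rewrite cd].
by case: c d {cd} => [c hc] [d hd] /= E; exact: eq_exist.
Qed.

Lemma isrc_equiv n (c : icell n.+1) : equiv (Src (irepr c)) (Src (irepr c)).
Proof.
move=> C; exists (src (ival C c));
  by exists (ival C c) => //; exact: ireprP.
Qed.

Lemma itgt_equiv n (c : icell n.+1) : equiv (Tgt (irepr c)) (Tgt (irepr c)).
Proof.
move=> C; exists (tgt (ival C c));
  by exists (ival C c) => //; exact: ireprP.
Qed.

Definition isrc n (c : icell n.+1) := iclass (isrc_equiv c).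
Definition itgt n (c : icell n.+1) := iclass (itgt_equiv c).

Lemma ival_src (C : owc) n (c : icell n.+1) : ival C (isrc c) = src (ival C c).
Proof. by apply: ival_class; exists (ival C c) => //; exact: ireprP. Qed.

Lemma ival_tgt (C : owc) n (c : icell n.+1) : ival C (itgt c) = tgt (ival C c).
Proof. by apply: ival_class; exists (ival C c) => //; exact: ireprP. Qed.

Program Definition iglob : globset := @Globset icell isrc itgt _ _.
Next Obligation.
by move=> n c; apply: ival_inj => C; rewrite !(ival_src, ival_tgt) src_src.
Qed.
Next Obligation.
by move=> n c; apply: ival_inj => C; rewrite !(ival_src, ival_tgt) tgt_src.
Qed.

Definition ivalg (C : owc) : gmap iglob C :=
  @Gmap iglob C (@ival C) (@ival_src C) (@ival_tgt C).

Lemma ival_map (C D : owc) (f : owc_map C D) n (c : iglob n) :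
  f n (ival C c) = ival D c.
Proof. exact: evals_fun (evals_map f (ireprP C c)) (ireprP D c). Qed.

(** The arity of a class is its value in the terminal
operad-with-contraction, whose cells are the elements of T1. *)
Definition icoll : coll := @Coll iglob (ivalg arity_owc).

Definition ivalc (C : owc) : cmap icoll C :=
  @Cmap icoll C (ivalg C) (@ival_map C arity_owc (to_arity C)).

(** * Operad structure and contraction on classes *)

(** A cell of T applied to the globular set of classes is represented by an
expression whose generators are classes; choosing a term in each of them
yields a diagram term. *)
Fixpoint diagram n (e : expr icell n) : term Diagram n :=
  match e in expr _ n return term Diagram n with
  | Gen n c => DGen (irepr c)
  | Idn n e => DIdn (diagram e)
  | Cmp p n h d e => DCmp h (diagram d) (diagram e)
  end.

(** Both sides are computed by the same recursion on an expression representing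
z, since [Tmap (ivalg C)] is the extension of [eta] after [ivalg C] to the free
strict omega-category. *)
Lemma diagramP (C : owc) n (z : T iglob n) :
  @evals C Diagram n (diagram (frepr z)) (Tmap (ivalg C) n z).
Proof.
have main m (e : expr icell m) (a : free C m) :
    eval (gcomp eta (ivalg C) : gmap iglob (free C)) e a ->
    @evals C Diagram m (diagram e) a.
  elim: e a => {m} [m c|m e IH|p m h d IHd e IHe] a /=.
  - by move=> ->; exists (ival C c) => //; exact: ireprP.
  - by move=> [b eb ->]; exists b => //; exact: IH.
  move=> [b [c [bc [db ec ->]]]]; exists b, c, bc.
  by split; [exact: IHd | exact: IHe |].
exact/main/fvalP.
Qed.

Definition imul_term n (x : tens icoll icoll n) : term Cell n :=
  Mul (diagram (frepr (sval x).1)) (irepr (sval x).2).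

Lemma imul_evals (C : owc) n (x : tens icoll icoll n) :
  evals (imul_term x) (omul n (tens_map (ivalc C) (ivalc C) n x)).
Proof.
exists (tens_map (ivalc C) (ivalc C) n x).
by split=> //=; [exact: diagramP | exact: ireprP].
Qed.

Lemma imul_equiv n (x : tens icoll icoll n) : equiv (imul_term x) (imul_term x).
Proof. by move=> C; eexists; exact: imul_evals. Qed.

Definition imulf n (x : tens icoll icoll n) : icell n := iclass (imul_equiv x).

Lemma ival_mul (C : owc) n (x : tens icoll icoll n) :
  ival C (imulf x) = omul n (tens_map (ivalc C) (ivalc C) n x).
Proof. exact/ival_class/imul_evals. Qed.

Program Definition imul : cmap (tens icoll icoll) icoll :=
  @Cmap (tens icoll icoll) icoll (@Gmap (tens icoll icoll) icoll imulf _ _) _.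
Next Obligation.
move=> n x; apply: ival_inj => C.
by rewrite [RHS]ival_src !ival_mul !gfun_src.
Qed.
Next Obligation.
move=> n x; apply: ival_inj => C.
by rewrite [RHS]ival_tgt !ival_mul !gfun_tgt.
Qed.
Next Obligation.
move=> n x /=; rewrite ival_mul.
exact: ar_cfun (tens_map (ivalc arity_owc) (ivalc arity_owc)) n x.
Qed.

Lemma iunit_equiv n : equiv (Unit n) (Unit n).
Proof. by move=> C; exists (ounit n tt). Qed.

Lemma ival_unit (C : owc) n : ival C (iclass (iunit_equiv n)) = ounit n tt.
Proof. exact: ival_class. Qed.

Program Definition iunit : cmap cunit icoll :=
  @Cmap cunit icoll (@Gmap one icoll (fun n _ => iclass (iunit_equiv n)) _ _) _.
Next Obligation.
move=> n x; apply: ival_inj => C.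
by rewrite [RHS]ival_src !ival_unit -gfun_src.
Qed.
Next Obligation.
move=> n x; apply: ival_inj => C.
by rewrite [RHS]ival_tgt !ival_unit -gfun_tgt.
Qed.
Next Obligation. by move=> n [] /=; rewrite ival_unit. Qed.

Lemma ivalc_mul (C : owc) :
  ccomp (ivalc C) imul = ccomp omul (tens_map (ivalc C) (ivalc C)).
Proof. by apply: cmapP => n x; exact: ival_mul. Qed.

Lemma ivalc_unit (C : owc) : ccomp (ivalc C) iunit = ounit.
Proof. by apply: cmapP => n []; exact: ival_unit. Qed.

Definition ioperad : operad := 
  @reflected_operad icoll imul iunit owc owc_op ivalc
    ival_inj ivalc_mul ivalc_unit.

Definition ivalo (C : owc) : operad_map ioperad C :=
  @OperadMap ioperad C (ivalc C) (ivalc_mul C) (ivalc_unit C).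

Section InitialContraction.
Variables (n : nat) (pi : T one n.+1) (q : ppair icoll pi).

Definition ikap_term := Kap pi (irepr (sval (pp0 q))) (irepr (sval (pp1 q))).

Lemma ikap_evals (C : owc) :
  evals ikap_term (sval (kap (owc_kap C) (ppair_map (ivalc C) q))).
Proof. by exists (ppair_map (ivalc C) q); split=> //=; exact: ireprP. Qed.

Lemma ikap_equiv : equiv ikap_term ikap_term.
Proof. by move=> C; eexists; exact: ikap_evals. Qed.

Lemma ival_kap (C : owc) :
  ival C (iclass ikap_equiv) = sval (kap (owc_kap C) (ppair_map (ivalc C) q)).
Proof. exact/ival_class/ikap_evals. Qed.

Lemma ar_ikap : @ar icoll n.+1 (iclass ikap_equiv) = pi.
Proof. by rewrite /= ival_kap. Qed.
End InitialContraction.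

Program Definition icontraction : contraction ioperad :=
  @Contraction ioperad
    (fun n pi q => exist _ (iclass (ikap_equiv q)) (ar_ikap q)) _ _.
Next Obligation.
by move=> n pi q; apply: ival_inj => C; rewrite [LHS]ival_src ival_kap src_kap.
Qed.
Next Obligation.
by move=> n pi q; apply: ival_inj => C; rewrite [LHS]ival_tgt ival_kap tgt_kap.
Qed.

(** * Initiality *)

Definition iowc : owc := Owc icontraction.

Program Definition valuation (C : owc) : owc_map iowc C :=
  @OwcMap iowc C (ivalo C) _.
Next Obligation. by move=> C n pi q; apply: fiberP; exact: ival_kap. Qed.

(** For any C, composing with the map [valuation C] shows that the value in C of
the value of c in the initial object is the value of c in C; joint
injectivity of the valuations concludes. *)
Lemma valuation_self n (c : iowc n) : valuation iowc n c = c.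
Proof. by apply: ival_inj => C; exact: (ival_map (valuation C)). Qed.

Theorem proposition4p1p2 : has_initial OWC.
Proof.
exists iowc => C; exists (valuation C); split=> // f _.
apply: owc_mapP => n c; rewrite -[in RHS](valuation_self c).
by rewrite [RHS](ival_map f).
Qed.
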